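(* Let $d \in \mathbb N$, $\gamma \in \mathbb N_0^d$ and $f \in \mathcal C^\gamma(\mathbb R^d)$. Then there exists a sequence $(q_n)_{n \in \mathbb N}$ of polynomials in $d$ variables with rational coefficients such that for all $\beta \in \mathbb N_0^d$ with $\beta \le \gamma$, $$\partial^\beta q_n \to \partial^\beta f \quad \text{locally uniformly on } \mathbb R^d \text{ as } n \to \infty.$$
   Context: For multiindices $\beta,\gamma \in \mathbb N_0^d$: $\beta \le \gamma$ means $\beta_j \le \gamma_j$ for all $j \in \{1,\ldots,d\}$, and $\partial^\beta f := \frac{\partial^{\beta_1}}{\partial x_1^{\beta_1}} \cdots \frac{\partial^{\beta_d}}{\partial x_d^{\beta_d}} f$. $\mathcal C^\gamma(\mathbb R^d)$ is the set of functions $f : \mathbb R^d \to \mathbb R$ such that all the partial derivatives $\partial^\beta f$ with $\beta \le \gamma$ exist and are continuous on $\mathbb R^d$. Locally uniform convergence on $\mathbb R^d$ means uniform convergence on each compact subset of $\mathbb R^d$. *)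

(* Defs.v *)
From mathcomp Require Import all_boot all_order all_algebra.
From mathcomp Require mpoly.
From mathcomp Require Import all_classical all_reals all_analysis.
Import numFieldNormedType.Exports.

Set Implicit Arguments.
Unset Strict Implicit.
Unset Printing Implicit Defensive.

Import Order.TTheory GRing.Theory Num.Theory.
Local Open Scope classical_set_scope.
Local Open Scope ring_scope.

Section MultiindexDerivatives.
Context {R : realType} {d : nat}.
Implicit Types (f : 'rV[R]_d -> R) (beta gamma : 'I_d -> nat) (s : seq 'I_d).

Definition pderiv (i : 'I_d) f : 'rV[R]_d -> R := 'D_(delta_mx 0 i) f.

(* The head of [s] is the outermost derivative: pderivs [:: i; j] f is
   (d/dx_i) (d/dx_j) f. *)
Definition pderivs s f : 'rV[R]_d -> R := foldr pderiv f s.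

(* ['D_v f] is total, so existence has to be required separately, for every
   derivative met in the iteration and at every point. *)
Fixpoint ex_pderivs s f : Prop :=
  if s is i :: s' then
    ex_pderivs s' f /\ forall x, derivable (pderivs s' f) x (delta_mx 0 i)
  else True.

(* beta 0 times the index 0, then beta 1 times the index 1, and so on. *)
Definition mword beta : seq 'I_d := flatten [seq nseq (beta i) i | i <- enum 'I_d].

Definition mpderiv beta f : 'rV[R]_d -> R := pderivs (mword beta) f.

Definition ex_mpderiv beta f : Prop := ex_pderivs (mword beta) f.

Definition C_multi gamma f : Prop :=
  forall beta, (forall i, beta i <= gamma i)%N ->
    ex_mpderiv beta f /\ continuous (mpderiv beta f).

Definition ratmpoly_fun (q : mpoly.mpoly d rat) : 'rV[R]_d -> R :=
  fun x => mpoly.meval (fun i => x 0 i) (mpoly.map_mpoly (@ratr R) q).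

Definition cvg_locally_uniform (g : nat -> 'rV[R]_d -> R) (h : 'rV[R]_d -> R)
    : Prop :=
  forall K : set 'rV[R]_d, compact K -> {uniform K, g @ \oo --> h}.

End MultiindexDerivatives.

(* Main.v *)
Require Import Defs.
From mathcomp Require Import all_boot all_order all_algebra.
From mathcomp Require mpoly.
From mathcomp Require Import all_classical all_reals all_analysis.
(* The notations for multivariate polynomials clash with those of analysis. *)
From mathcomp Require Import -(notations) mpoly.
From mathcomp Require Import ring lra.
Import numFieldNormedType.Exports.
Import Order.TTheory GRing.Theory Num.Theory.

(** Tensor-product Bernstein polynomials approximate a function together with
    all the derivatives it has, and they depend on the function only through
    finitely many values, which may be rounded to rationals.

    Fix the cube [-r, r]^d, a degree m and the mesh h = 2r/m, and write
    u_i = (x_i + r)/(2r).  By de Casteljau's algorithm, the Bernstein polynomial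
    of F is obtained by applying, at the corner (-r, ..., -r) and m times for
    each coordinate i, the operator F |-> u_i F(. + h e_i) + (1 - u_i) F.  These
    operators commute with each other and with the differences
    F |-> F(. + h e_i) - F, so only the number of steps in each direction
    matters; a product of them is a positive operator that fixes constants,
    namely the expectation over a random walk.

    Differentiating in x_j removes one step in direction j, replaces F by its
    difference in direction j and multiplies by (number of j-steps)/(2r)
    (is_derive_casteljau, pderivs_casteljau).  For a derivative word w of length
    k this leaves the factor (1 + O(1/m)) h^-k (deriv_factor_bounds) in front of
    the operator applied to an iterated difference of F.  By the mean value
    theorem in one coordinate after the other, the iterated difference of f
    equals h^k times the derivative of f along w at a point within kh of the
    node (fdiffs_mean_value).  The mean value theorem is applied to the innermost
    derivative first and the differences commute, so the order of
    differentiation in the definition of C^gamma is respected, without appeal to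
    the symmetry of mixed derivatives.

    It remains that the operator applied to a function close to a continuous g
    gives back g up to a small error.  As in the probabilistic proof of
    Weierstrass' theorem, on a cube |g z - g x| <= e + C |z - x|^2
    (quadratic_modulus), and the operator applied to |z - x|^2 is O(h)
    (casteljau_moment).  This yields bernstein_estimate, in which an error of
    size h^(k+1) in the values of f is allowed for: k differences and the factor
    h^-k turn it into O(h).  Hence the values may be rounded to rationals, and
    with r an integer the polynomial has rational coefficients.  A polynomial
    good to within 1/(n+1) on the cube of half-side n+1, chosen for each n, gives
    the sequence. *)

Set Implicit Arguments.
Unset Strict Implicit.
Unset Printing Implicit Defensive.

Local Open Scope classical_set_scope.
Local Open Scope ring_scope.

(** * De Casteljau steps and finite differences *)

Section Casteljau.
Context {R : realType} {d : nat}.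
Implicit Types (h : R) (p : 'I_d -> R) (F G : 'rV[R]_d -> R) (s w : seq 'I_d)
  (i j : 'I_d) (x y z : 'rV[R]_d).

Local Notation basis i := (delta_mx 0 i : 'rV[R]_d).

Definition fdiff h i F : 'rV[R]_d -> R := fun y => F (y + h *: basis i) - F y.

Definition fdiffs h s F : 'rV[R]_d -> R := foldr (fdiff h) F s.

(** The expectation of F after one random step, which moves by h in direction i
    with probability p i and stays put otherwise. *)
Definition casteljau_step h p i F : 'rV[R]_d -> R :=
  fun y => p i * F (y + h *: basis i) + (1 - p i) * F y.

(** When s contains each i exactly m times and y is the corner of a grid of mesh
    h, this is the tensor Bernstein polynomial of degree m, with p the barycentric
    coordinates of the point of evaluation. *)
Definition casteljau h p s F : 'rV[R]_d -> R := foldr (casteljau_step h p) F s.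

Lemma fdiffC h i j F : fdiff h i (fdiff h j F) = fdiff h j (fdiff h i F).
Proof.
apply/funext => y; rewrite /fdiff [y + _ + _]addrAC; ring.
Qed.

Lemma fdiffs_rcons h s i F : fdiffs h (rcons s i) F = fdiff h i (fdiffs h s F).
Proof.
elim: s => [//|j s IH]; rewrite /= -/(fdiffs _ _ _) IH.
by rewrite fdiffC.
Qed.

Lemma fdiffsB h s F G : fdiffs h s (F \- G) = fdiffs h s F \- fdiffs h s G.
Proof.
elim: s => //= i s; rewrite -!/(fdiffs _ _ _) => ->.
by apply/funext => y; rewrite /fdiff /=; ring.
Qed.

Lemma fdiffs_bound h s F (e : R) : (forall y, `|F y| <= e) ->
  forall y, `|fdiffs h s F y| <= 2 ^+ size s * e.
Proof.
move=> Fe; elim: s => [|i s IH] y /=; first by rewrite mul1r.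
apply: (le_trans (ler_normB _ _)).
rewrite exprS -mulrA.
rewrite [leRHS](_ : _ = 2 ^+ size s * e + 2 ^+ size s * e); last by ring.
by rewrite lerD // IH.
Qed.

Lemma casteljau_stepC h p i j F :
  casteljau_step h p i (casteljau_step h p j F) =
  casteljau_step h p j (casteljau_step h p i F).
Proof.
apply/funext => y; rewrite /casteljau_step [y + _ + _]addrAC; ring.
Qed.

(** The steps commute, so any of them can be taken first. *)
Lemma casteljau_rem h p s j F : j \in s ->
  casteljau_step h p j (casteljau h p (rem j s) F) = casteljau h p s F.
Proof.
elim: s => //= i s IH; rewrite inE; have [-> //|ij /= js] := eqVneq i j.
by rewrite /= casteljau_stepC -/(casteljau _ _ _ _) IH.
Qed.

Lemma casteljau_fdiff h p s j F :
  casteljau h p s (fdiff h j F) = fdiff h j (casteljau h p s F).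
Proof.
elim: s => //= i s; rewrite -!/(casteljau _ _ _ _) => ->.
apply/funext => y; rewrite /casteljau_step /fdiff [y + _ + _]addrAC; ring.
Qed.

Lemma casteljauD h p s F G :
  casteljau h p s (F \+ G) = casteljau h p s F \+ casteljau h p s G.
Proof.
elim: s => //= i s; rewrite -!/(casteljau _ _ _ _) => ->.
by apply/funext => y; rewrite /casteljau_step /=; ring.
Qed.

Lemma casteljauZ h p s (c : R) F :
  casteljau h p s (fun y => c * F y) = (fun y => c * casteljau h p s F y).
Proof.
elim: s => //= i s; rewrite -!/(casteljau _ _ _ _) => ->.
by apply/funext => y; rewrite /casteljau_step /=; ring.
Qed.

Lemma casteljau_cst h p s (c : R) : casteljau h p s (fun=> c) = fun=> c.
Proof.
elim: s => //= i s; rewrite -!/(casteljau _ _ _ _) => ->.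
by apply/funext => y; rewrite /casteljau_step /=; ring.
Qed.

Lemma casteljau_sum h p s (G : 'I_d -> 'rV[R]_d -> R) y :
  casteljau h p s (fun z => \sum_i G i z) y = \sum_i casteljau h p s (G i) y.
Proof.
elim: s y => //= i s IH y; rewrite -!/(casteljau _ _ _ _) /casteljau_step !IH.
by rewrite !mulr_sumr -big_split.
Qed.

(** Positivity.  The inequality is only available at the nodes of the grid, which
    is why it is asked for in the part of space that the walk s can reach. *)
Lemma le_casteljau h p s F G y : 0 <= h -> (forall i, 0 <= p i <= 1) ->
  (forall z, (forall i, y 0 i <= z 0 i <= y 0 i + h * (count_mem i s)%:R) ->
     F z <= G z) ->
  casteljau h p s F y <= casteljau h p s G y.
Proof.
move=> h0 p01; elim: s y => [|j s IH] y FG /=.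
  by apply: FG => i; rewrite mulr0 addr0 lexx.
have /andP[p0 p1] := p01 j.
rewrite -!/(casteljau _ _ _ _) /casteljau_step.
apply: lerD; apply: ler_wpM2l; rewrite ?subr_ge0 //; apply: IH => z zy;
  apply: FG => i; have /andP[yz zy'] := zy i; move: yz zy';
  rewrite ?mxE /= [j == i]eq_sym; case: (i == j) => /=; rewrite ?natrD => yz zy';
  apply/andP; split; nra.
Qed.

(** The second moment of the walk in coordinate i, as squared bias plus variance
    of a binomial variable with count_mem i s trials. *)
Lemma casteljau_moment h p s i (b : R) y :
  casteljau h p s (fun z => (z 0 i - b) ^+ 2) y =
  (y 0 i - b + h * (count_mem i s)%:R * p i) ^+ 2
    + h ^+ 2 * (count_mem i s)%:R * (p i * (1 - p i)).
Proof.
elim: s y => [|j s IH] y /=; first by rewrite !mulr0 !mul0r !addr0.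
rewrite -!/(casteljau _ _ _ _) /casteljau_step !IH !mxE /= [i == j]eq_sym.
case: eqVneq => [->|_] /=; rewrite ?natrD; ring.
Qed.

End Casteljau.

(** * Differentiation and mean values *)

Section MeanValue.
Context {R : realType} {d : nat}.
Implicit Types (h : R) (p : 'I_d -> R) (F G f g : 'rV[R]_d -> R) (s w : seq 'I_d)
  (i j : 'I_d) (x y z v : 'rV[R]_d).

Local Notation basis i := (delta_mx 0 i : 'rV[R]_d).

Lemma is_derive_translate f v (w : 'rV[R]_d) x (df : R) :
  is_derive (x + w) v f df -> is_derive x v (fun y => f (y + w)) df.
Proof.
have E : (fun h : R =>
      h^-1 *: (((fun y => f (y + w)) \o shift x) (h *: v) - f (x + w))) =
    (fun h : R => h^-1 *: ((f \o shift (x + w)) (h *: v) - f (x + w))).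
  by apply/funext => h /=; rewrite addrA.
by case=> D1 D2; split; rewrite /derivable /derive E.
Qed.

Lemma is_derive_line f v y (t df : R) :
  is_derive (y + t *: v) v f df -> is_derive t 1 (fun r : R => f (y + r *: v)) df.
Proof.
have E : (fun h : R => h^-1 *:
      (((fun r : R => f (y + r *: v)) \o shift t) (h *: 1) - f (y + t *: v))) =
    (fun h : R =>
      h^-1 *: ((f \o shift (y + t *: v)) (h *: v) - f (y + t *: v))).
  apply/funext => h /=; congr (_ *: (f _ - _)).
  by rewrite [h *: 1]mulr1 scalerDl addrCA.
by case=> D1 D2; split; rewrite /derivable /derive E.
Qed.

Lemma is_derive_fdiff h i v F (dF : 'rV[R]_d -> R) :
  (forall x, is_derive x v F (dF x)) ->
  forall x, is_derive x v (fdiff h i F) (fdiff h i dF x).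
Proof.
by move=> DF x; apply: is_deriveB; apply: is_derive_translate.
Qed.

Lemma is_derive_fdiffs h s v F (dF : 'rV[R]_d -> R) :
  (forall x, is_derive x v F (dF x)) ->
  forall x, is_derive x v (fdiffs h s F) (fdiffs h s dF x).
Proof.
by move=> DF; elim: s => //= i s IH x; apply: is_derive_fdiff.
Qed.

Lemma fdiff_mean_value h i F (dF : 'rV[R]_d -> R) y : 0 <= h ->
  (forall x, is_derive x (basis i) F (dF x)) ->
  exists2 t, 0 <= t <= h & fdiff h i F y = h * dF (y + t *: basis i).
Proof.
move=> h0 DF.
have Dl (t : R) : is_derive t (1 : R) (fun r : R => F (y + r *: basis i))
    (dF (y + t *: basis i)).
  exact: is_derive_line.
have [|t tI E] := @MVT_segment R _ _ 0 h h0 (fun t _ => Dl t).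
  by apply: derivable_within_continuous => t _; case: (Dl t).
by exists t => //; rewrite mulrC -[X in _ * X](subr0 h) -E scale0r addr0.
Qed.

Lemma pderivs_rcons s i f : pderivs (rcons s i) f = pderivs s (pderiv i f).
Proof. by rewrite /pderivs -cats1 foldr_cat. Qed.

Lemma ex_pderivs_rcons s i f : ex_pderivs (rcons s i) f ->
  (forall x, derivable f x (basis i)) /\ ex_pderivs s (pderiv i f).
Proof.
elim: s => [|j s IH] /=; first by case.
by rewrite pderivs_rcons => -[/IH[Df Es] Ds].
Qed.

(** The word is consumed from its innermost derivative: the difference in that
    direction commutes with the others, so the one-dimensional theorem applies to
    the other differences of f, and what remains is the statement for the
    derivative of f.  Only derivatives in the order given by the word occur. *)
Lemma fdiffs_mean_value h s f y : 0 <= h -> ex_pderivs s f ->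
  exists z : 'rV[R]_d,
    (forall i, y 0 i <= z 0 i <= y 0 i + h * (size s)%:R) /\
    fdiffs h s f y = h ^+ size s * pderivs s f z.
Proof.
move=> h0; elim/last_ind: s f y => [|s i IH] f y.
  by exists y; split=> [i|]; rewrite /= ?mulr0 ?addr0 ?lexx ?mul1r.
move=> /ex_pderivs_rcons[Df Es].
have [t /andP[t0 th] Et] := @fdiff_mean_value h i _ _ y h0
  (@is_derive_fdiffs h s _ _ _ (fun x => derivableP (Df x))).
have [z [zP Ez]] := IH (pderiv i f) (y + t *: basis i) Es.
exists z; split=> [j|].
  have := zP j; rewrite !mxE size_rcons /= -natr1.
  by case: (j == i) => /= /andP[? ?]; apply/andP; split; nra.
by rewrite fdiffs_rcons Et -/(pderiv i f) Ez pderivs_rcons size_rcons exprS mulrA.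
Qed.

Lemma is_derive_coord i j x :
  is_derive x (basis j) (fun z => z 0 i) (i == j)%:R.
Proof.
have E : (fun h : R =>
    h^-1 *: (((fun z => z 0 i : R) \o shift x) (h *: basis j) - x 0 i)) @ 0^'
    --> ((i == j)%:R : R).
  apply: cvg_near_cst; near=> h; rewrite /= !mxE /= addrK scalerA mulVf ?scale1r //.
  by near: h; exact: nbhs_dnbhs_neq.
by split; [apply/cvg_ex; exists (i == j)%:R | exact: cvg_lim].
Unshelve. all: by end_near. Qed.

(** Each j-step contributes, through the derivative 1/L of its weight, the
    difference in direction j in place of that step; since steps and differences
    commute, all the contributions are equal. *)
Lemma is_derive_casteljau h (a L : R) s j F y x :
  is_derive x (basis j)
    (fun x => casteljau h (fun i => (x 0 i - a) / L) s F y)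
    ((count_mem j s)%:R / L *
      casteljau h (fun i => (x 0 i - a) / L) (rem j s) (fdiff h j F) y).
Proof.
elim: s y => [|i s IH] y.
  by rewrite /= !mul0r; apply: is_derive_cst.
have Du : is_derive x (basis j) (fun z => (z 0 i - a) / L) ((i == j)%:R / L).
  have -> : (fun z => (z 0 i - a) / L) = ((fun z => z 0 i) - cst a) * cst L^-1 by [].
  have ? := is_derive_coord i j x.
  by apply: is_derive_eq; rewrite /= scaler0 add0r subr0 [LHS]mulrC.
have -> : (fun x => casteljau h (fun i => (x 0 i - a) / L) (i :: s) F y) =
  (fun x => (x 0 i - a) / L) *
  (fun x => casteljau h (fun i => (x 0 i - a) / L) s F (y + h *: basis i)) +
  (cst 1 - (fun x => (x 0 i - a) / L)) *
  (fun x => casteljau h (fun i => (x 0 i - a) / L) s F y) by [].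
have ? := IH y.
have ? := IH (y + h *: basis i).
apply: is_derive_eq; rewrite /= /GRing.scale /=.
rewrite !casteljau_fdiff; case: eqVneq => [->|ij] /=.
  case: (boolP (j \in s)) => js.
    by rewrite -(casteljau_rem h _ F js) /casteljau_step /fdiff; rewrite !fctE; ring.
  by rewrite (count_memPn js) rem_id // /fdiff !fctE; ring.
by rewrite -/(casteljau _ _ _ _) /casteljau_step /fdiff !fctE [y + _ + _]addrAC; ring.
Qed.

End MeanValue.

(** * A quadratic modulus of continuity on cubes *)

Section Modulus.
Context {R : realType} {d : nat}.
Implicit Types (g : 'rV[R]_d -> R) (x y z : 'rV[R]_d).

Definition cube (r : R) : set 'rV[R]_d := [set x | forall i, -r <= x 0 i <= r].

Lemma cube_compact r : compact (cube r).
Proof.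
apply: (@rV_compact R d (fun=> `[-r, r]%classic)) => _.
exact: segment_compact.
Qed.

Lemma compact_sub_cube (K : set 'rV[R]_d) : compact K ->
  exists n : nat, forall m : nat, (n <= m)%N -> K `<=` cube m.+1%:R.
Proof.
move=> /compact_bounded[M [_ KM]].
pose b := `|M| + 1.
have [n nb] : exists n : nat, b <= n%:R.
  by exists (Num.trunc b).+1; rewrite ltW // truncnS_gt.
exists n => m nm x Kx i.
rewrite -ler_norml; apply: (le_trans (y := `|x|)).
  by rewrite [leRHS]mx_normrE; apply: (le_bigmax _ _ (0, i)).
apply: (le_trans (KM b _ x Kx)); first by rewrite /b; have := ler_norm M; lra.
by apply: (le_trans nb); rewrite ler_nat leqW.
Qed.

Lemma cube_bounded g r : continuous g ->
  exists2 M, 0 <= M & forall x, cube r x -> `|g x| <= M.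
Proof.
move=> cg.
have /compact_bounded[M [_ gM]] : compact (g @` cube r).
  by apply: continuous_compact; [exact: continuous_subspaceT | exact: cube_compact].
exists (`|M| + 1) => [|x xr]; first by rewrite addr_ge0.
by apply: gM; [have := ler_norm M; lra | exists x].
Qed.

(** Near the diagonal this is continuity; away from it |z - x| is bounded below
    and boundedness of g suffices.  Compactness makes C uniform in x. *)
Lemma quadratic_modulus g r (e : R) : continuous g -> 0 < e ->
  exists2 C, 0 <= C & forall x z, cube r x -> cube r z ->
    `|g z - g x| <= e + C * \sum_i (z 0 i - x 0 i) ^+ 2.
Proof.
move=> cg e0.
have [M M0 gM] := cube_bounded r cg.
have /compact_near_coveringP/(_ R +oo%R (fun C x => cube r x -> forall z, cube r z ->
    `|g z - g x| <= e + C * \sum_i (z 0 i - x 0 i) ^+ 2)) := @cube_compact r.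
have S0 x z : 0 <= \sum_i (z 0 i - x 0 i) ^+ 2 :> R.
  by apply: sumr_ge0 => i _; exact: sqr_ge0.
case.
  move=> x xr.
  have e2 : 0 < e / 2 by lra.
  have /(_ _ _ e2) := (cvgrPdist_lt _ _).1 (cg x).
  move=> /nbhs_ballP[t /= t0 gt].
  have t2 : 0 < t / 2 by lra.
  (* With x' within t/2 of x, either z is within t of x, or it is at distance
     at least t/2 from x' and C (t/2)^2 exceeds the oscillation 2M. *)
  exists (ball x (t / 2), [set C : R | 2 * M / (t / 2) ^+ 2 <= C]).
    by split => /=; [exact: nbhsx_ballx | apply: nbhs_pinfty_ge; exact: num_real].
  move=> [x' C] [/= [_ xx'] CM] x'r z zr.
  have C0 : 0 <= C.
    by apply: le_trans CM; rewrite divr_ge0 ?sqr_ge0 // mulr_ge0.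
  have gx' : `|g x - g x'| < e / 2.
    by apply: gt; split => // i j; apply: le_ball (xx' i j); lra.
  have [zx'|/existsNP[i /negP]] := pselect (forall i, `|z 0 i - x' 0 i| < t / 2).
    have gz : `|g x - g z| < e / 2.
      apply: gt; split => // i j; rewrite ord1.
      have := xx' 0 j; have := zx' j; rewrite /ball /=.
      by rewrite !ltr_norml => /andP[? ?] /andP[? ?]; apply/andP; split; lra.
    apply: (@le_trans _ _ e); last by rewrite lerDl mulr_ge0.
    move: gz gx'; rewrite !ltr_norml ler_norml => /andP[? ?] /andP[? ?].
    by apply/andP; split; lra.
  rewrite -leNgt => ti.
  have t2S : (t / 2) ^+ 2 <= \sum_i (z 0 i - x' 0 i) ^+ 2.
    rewrite (bigD1 i) //= -[(z 0 i - _) ^+ 2]real_normK ?num_real //.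
    rewrite -[leLHS]addr0 lerD //; last by apply: sumr_ge0 => ? _; exact: sqr_ge0.
    by rewrite ler_sqr ?nnegrE // ltW.
  apply: (@le_trans _ _ (2 * M)).
    by apply: (le_trans (ler_normB _ _)); have := gM _ zr; have := gM _ x'r; lra.
  have : 2 * M <= C * \sum_i (z 0 i - x' 0 i) ^+ 2.
    move: CM; rewrite ler_pdivrMr ?exprn_gt0 // => CM.
    by apply: (le_trans CM); rewrite ler_wpM2l.
  by have := ltW e0; lra.
move=> A [_ HA].
exists (`|A| + 1) => [|x z xr zr]; first by rewrite addr_ge0.
by apply: HA => //; have := ler_norm A; lra.
Qed.

End Modulus.

(** * Convergence of the derivatives of Bernstein polynomials *)

Section BernsteinEstimate.
Context {R : realType} {d : nat}.
Implicit Types (h : R) (p : 'I_d -> R) (F G f g : 'rV[R]_d -> R) (s w : seq 'I_d)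
  (i j : 'I_d) (x y z : 'rV[R]_d).

Local Notation basis i := (delta_mx 0 i : 'rV[R]_d).

Definition remove_word s w : seq 'I_d := foldr (fun j t => rem j t) s w.

(** The product of the factors (number of j-steps left)/L picked up when
    differentiating along w, from its innermost letter outwards. *)
Fixpoint deriv_factor (L : R) s w : R :=
  if w is j :: w' then
    (count_mem j (remove_word s w'))%:R / L * deriv_factor L s w'
  else 1.

Lemma count_remove_word s w i :
  count_mem i (remove_word s w) = (count_mem i s - count_mem i w)%N.
Proof.
elim: w => [|j w IH] /=; first by rewrite subn0.
by rewrite count_mem_rem IH -subnDA addnC.
Qed.

Lemma pderivs_casteljau h (a L : R) s w F y :
  pderivs w (fun x => casteljau h (fun i => (x 0 i - a) / L) s F y) =
  fun x => deriv_factor L s w *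
    casteljau h (fun i => (x 0 i - a) / L) (remove_word s w) (fdiffs h w F) y.
Proof.
elim: w => [|j w IH] /=; first by apply/funext => x; rewrite mul1r.
rewrite -/(pderivs _ _) IH; apply/funext => x; rewrite /pderiv.
have D := is_derive_casteljau h a L (remove_word s w) j (fdiffs h w F) y x.
have ? := is_derive_cst (deriv_factor L s w) x (basis j).
have -> : (fun x => deriv_factor L s w *
    casteljau h (fun i => (x 0 i - a) / L) (remove_word s w) (fdiffs h w F) y) =
  cst (deriv_factor L s w) * (fun x =>
    casteljau h (fun i => (x 0 i - a) / L) (remove_word s w) (fdiffs h w F) y) by [].
rewrite derive_val /GRing.scale /= mulr0 addr0.
ring.
Qed.

(** After scaling by h^k, with h = L/m, the factor is a product of k numbers of
    the form max(m - c, 0)/m with c <= k. *)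
Lemma deriv_factor_bounds (L : R) m s w : (0 < m)%N -> 0 < L ->
  (forall i, count_mem i s = m) ->
  0 <= deriv_factor L s w * (L / m%:R) ^+ size w <= 1 /\
  1 - (size w)%:R ^+ 2 / m%:R <= deriv_factor L s w * (L / m%:R) ^+ size w.
Proof.
move=> m0 L0 sm.
have m0' : 0 < m%:R :> R by rewrite ltr0n.
elim: w => [|j w [/andP[IH0 IH1] IH2]] /=.
  by rewrite mul1r ler01 lexx expr0n /= mul0r subr0 lexx.
rewrite count_remove_word sm.
set k := deriv_factor _ _ _ * _ in IH0 IH1 IH2.
set c : R := (m - count_mem j w)%:R / m%:R.
have -> : (m - count_mem j w)%:R / L * deriv_factor L s w * (L / m%:R) ^+ (size w).+1
    = c * k.
  by rewrite exprS /c /k; field; rewrite !gt_eqF.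
have c0 : 0 <= c by rewrite divr_ge0.
have c1 : c <= 1 by rewrite ler_pdivrMr // mul1r ler_nat leq_subr.
have c2 : 1 - (size w)%:R / m%:R <= c.
  rewrite ler_pdivlMr // mulrBl mul1r divfK ?gt_eqF // lerBlDr -natrD ler_nat.
  apply: (@leq_trans (m - count_mem j w + count_mem j w)%N).
    by rewrite addnC -leq_subLR.
  by rewrite leq_add2l count_size.
split; first by apply/andP; split; nra.
apply: (@le_trans _ _ (1 - ((size w)%:R ^+ 2 / m%:R + (size w)%:R / m%:R))).
  rewrite lerD2l lerN2 -mulrDl ler_wpM2r ?invr_ge0 ?ltW //.
  by rewrite -natr1; have := ler0n R (size w); nra.
have : 0 <= (size w)%:R / m%:R :> R by rewrite divr_ge0.
nra.
Qed.

Lemma casteljau_dist h p s F G (c : R) y : 0 <= h -> (forall i, 0 <= p i <= 1) ->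
  (forall z, (forall i, y 0 i <= z 0 i <= y 0 i + h * (count_mem i s)%:R) ->
     `|F z - c| <= G z) ->
  `|casteljau h p s F y - c| <= casteljau h p s G y.
Proof.
move=> h0 p01 FG.
have up : casteljau h p s F y <= c + casteljau h p s G y.
  have -> : c + casteljau h p s G y = casteljau h p s ((fun=> c) \+ G) y.
    by rewrite casteljauD casteljau_cst.
  by apply: le_casteljau => // z /FG; rewrite ler_norml => /andP[_ ?] /=; lra.
have dn : c <= casteljau h p s F y + casteljau h p s G y.
  have -> : casteljau h p s F y + casteljau h p s G y = casteljau h p s (F \+ G) y.
    by rewrite casteljauD.
  have -> : c = casteljau h p s (fun=> c) y by rewrite casteljau_cst.
  by apply: le_casteljau => // z /FG; rewrite ler_norml => /andP[? _] /=; lra.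
by rewrite ler_norml; apply/andP; split; lra.
Qed.

Lemma casteljau_quadratic h p s (A B : R) x y :
  casteljau h p s (fun z => A + B * \sum_i (z 0 i - x 0 i) ^+ 2) y =
  A + B * \sum_i ((y 0 i - x 0 i + h * (count_mem i s)%:R * p i) ^+ 2
    + h ^+ 2 * (count_mem i s)%:R * (p i * (1 - p i))).
Proof.
have -> : (fun z => A + B * \sum_i (z 0 i - x 0 i) ^+ 2) =
  (fun=> A) \+ (fun z => B * \sum_i (z 0 i - x 0 i) ^+ 2) by [].
rewrite casteljauD casteljau_cst casteljauZ /=.
rewrite (casteljau_sum h p s (fun i z => (z 0 i - x 0 i) ^+ 2)).
by congr (_ + _ * _); apply: eq_bigr => i _; exact: casteljau_moment.
Qed.

(** Up to the tolerance e the error is O(h), with a constant that does not depend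
    on the approximate values F of f, as long as these are within h^(k+1) where k
    is the length of w. *)
Lemma bernstein_estimate (r e : R) w f : 0 < r -> 0 < e ->
  ex_pderivs w f -> continuous (pderivs w f) ->
  exists C, forall m s F, let h := 2 * r / m%:R in
    (0 < m)%N -> h <= 1 -> (forall i, count_mem i s = m) ->
    (forall y, `|F y - f y| <= h ^+ (size w).+1) ->
    forall x, cube r x ->
    `|pderivs w (fun x =>
          casteljau h (fun i => (x 0 i - - r) / (2 * r)) s F (const_mx (- r))) x
      - pderivs w f x| <= e + C * h.
Proof.
move=> r0 e0 Ef cf.
set g := pderivs w f.
pose k : R := (size w)%:R.
have k0 : 0 <= k by exact: ler0n.
have rk : r <= r + k by rewrite lerDl.
have [M M0 gM] := cube_bounded r cf.
have [D D0 gD] := quadratic_modulus (r + k) cf e0.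
exists (2 ^+ size w + D * d%:R * (2 * k ^+ 2) +
   2 * D * d%:R * (k ^+ 2 + 2 * r) + k ^+ 2 / (2 * r) * M).
move=> m s F h m0 h1 sm Ff x xr.
have m0' : 0 < m%:R :> R by rewrite ltr0n.
have h0 : 0 < h by rewrite /h divr_gt0 // mulr_gt0.
have hm : h * m%:R = 2 * r by rewrite /h mulfVK // gt_eqF.
pose p i := (x 0 i - - r) / (2 * r).
have r2 : 0 < 2 * r by rewrite mulr_gt0.
have p01 i : 0 <= p i <= 1.
  have /andP[xr1 xr2] := xr i.
  by rewrite /p divr_ge0 ?ler_pdivrMr //=; lra.
have xp i : x 0 i = - r + 2 * r * p i.
  by rewrite /p; field; rewrite gt_eqF.
rewrite pderivs_casteljau -/p.
set c := deriv_factor _ _ _; set s' := remove_word s w.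
have [/andP[]] := deriv_factor_bounds w m0 r2 sm.
rewrite -/h -/c; set K := c * h ^+ size w => K0 K1 K2.
have hk0 : 0 < h ^+ size w by rewrite exprn_gt0.
have c0 : 0 <= c by move: K0; rewrite /K pmulr_lge0.
have /boolp.choice[xi xiP] := fun y => fdiffs_mean_value y (ltW h0) Ef.
(* At the node z, the difference of F deviates from h^k g(x) by at most
   A + B |z - x|^2: the terms of A come from the error F - f, from the modulus of
   continuity, and from the distance kh between z and the mean value point. *)
pose A := h ^+ size w * (2 ^+ size w * h + e + D * d%:R * (2 * (k * h) ^+ 2)).
pose B := h ^+ size w * (2 * D).
have B0 : 0 <= B by rewrite !mulr_ge0 // ltW.
have main : `|casteljau h p s' (fdiffs h w F) (const_mx (- r)) - h ^+ size w * g x|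
    <= A + B * (d%:R * (h * (k ^+ 2 + 2 * r))).
  apply: (@le_trans _ _ (casteljau h p s'
    (fun z => A + B * \sum_i (z 0 i - x 0 i) ^+ 2) (const_mx (- r)))); last first.
    rewrite casteljau_quadratic lerD2l ler_wpM2l //.
    apply: (@le_trans _ _ (\sum_(i < d) h * (k ^+ 2 + 2 * r))); last first.
      by rewrite sumr_const card_ord [d%:R * _]mulr_natl.
    apply: ler_sum => i _; rewrite mxE xp count_remove_word sm.
    set n := (m - count_mem i w)%N.
    have nm : n%:R <= m%:R :> R by rewrite ler_nat leq_subr.
    have mn : m%:R <= n%:R + k.
      rewrite -natrD ler_nat; apply: (@leq_trans (n + count_mem i w)%N).
        by rewrite addnC -leq_subLR.
      by rewrite leq_add2l count_size.
    have n0 : 0 <= n%:R :> R by exact: ler0n.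
    have /andP[p0 p1] := p01 i.
    (* Between 0 and k steps in direction i were removed by differentiation, so
       the walk falls short of x on average by at most kh. *)
    have -> : - r - (- r + 2 * r * p i) + h * n%:R * p i
      = - (h * ((m%:R - n%:R) * p i)) by rewrite -hm; ring.
    have q0 : 0 <= (m%:R - n%:R) * p i by rewrite mulr_ge0 // subr_ge0.
    have qk : (m%:R - n%:R) * p i <= k by nra.
    have hh : h ^+ 2 <= h by nra.
    rewrite sqrrN exprMn [h * (_ + _)]mulrDr lerD //.
      by rewrite ler_pM ?sqr_ge0 // ler_sqr ?nnegrE.
    have -> : h * (2 * r) = h ^+ 2 * m%:R * 1 by rewrite -hm; ring.
    have pp : p i * (1 - p i) <= 1 by have := sqr_ge0 (p i); lra.
    have h20 : 0 <= h ^+ 2 by exact: sqr_ge0.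
    apply: ler_pM => //; first exact: mulr_ge0.
      by rewrite mulr_ge0 // subr_ge0.
    exact: ler_wpM2l.
  apply: casteljau_dist => [|//|z zr]; first exact: ltW.
  have zP i : - r <= z 0 i <= r.
    have := zr i; rewrite mxE count_remove_word sm => /andP[z1 z2].
    apply/andP; split => //; apply: (le_trans z2).
    have : h * (m - count_mem i w)%:R <= h * m%:R.
      by rewrite ler_wpM2l ?(ltW h0) // ler_nat leq_subr.
    by rewrite hm; lra.
  have [xiz Exi] := xiP z.
  have hkk : h * k <= k by nra.
  have err : `|fdiffs h w F z - fdiffs h w f z| <= 2 ^+ size w * h ^+ (size w).+1.
    have := fdiffs_bound (F := F \- f) h w Ff z.
    by rewrite fdiffsB.
  have xr' : cube (r + k) x.
    by move=> i; have /andP[? ?] := xr i; apply/andP; split; lra.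
  have xir : cube (r + k) (xi z).
    move=> i; have /andP[? ?] := xiz i; have /andP[? ?] := zP i.
    by rewrite -/k in xiz *; apply/andP; split; lra.
  have gd := gD _ _ xr' xir.
  have S : \sum_i (xi z 0 i - x 0 i) ^+ 2 <=
      2 * \sum_i (z 0 i - x 0 i) ^+ 2 + d%:R * (2 * (k * h) ^+ 2).
    apply: (@le_trans _ _ (\sum_(i < d) (2 * (z 0 i - x 0 i) ^+ 2 + 2 * (k * h) ^+ 2))).
      apply: ler_sum => i _; have /andP[a1 a2] := xiz i.
      set a := z 0 i - x 0 i; have -> : xi z 0 i - x 0 i = a + (xi z 0 i - z 0 i).
        by rewrite /a; ring.
      rewrite -/k in a2; set b := xi z 0 i - z 0 i.
      have b2 : b ^+ 2 <= (k * h) ^+ 2.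
        by rewrite ler_sqr ?nnegrE ?subr_ge0 ?mulr_ge0 ?(ltW h0) // /b; lra.
      by have := sqr_ge0 (a - b); nra.
    by rewrite big_split /= sumr_const card_ord -mulr_sumr [d%:R * _]mulr_natl.
  rewrite (_ : fdiffs h w F z - h ^+ size w * g x = (fdiffs h w F z - fdiffs h w f z)
    + h ^+ size w * (g (xi z) - g x)); last by rewrite Exi /g; ring.
  apply: (le_trans (ler_normD _ _)).
  rewrite normrM (ger0_norm (ltW hk0)).
  set S1 := \sum_i _ in S; set S2 := \sum_i (z 0 i - x 0 i) ^+ 2 in S *.
  have gd' : `|g (xi z) - g x| <= e + D * (2 * S2 + d%:R * (2 * (k * h) ^+ 2)).
    by apply: (le_trans gd); rewrite lerD2l ler_wpM2l.
  have := ler_wpM2l (ltW hk0) gd'.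
  by move: err; rewrite exprS /A /B; lra.
set T := casteljau _ _ _ _ _ in main *.
rewrite (_ : c * T - g x = c * (T - h ^+ size w * g x) + (K - 1) * g x); last first.
  by rewrite /K; ring.
apply: (le_trans (ler_normD _ _)).
have K10 : K - 1 <= 0 by rewrite subr_le0.
rewrite !normrM (ger0_norm c0) (ler0_norm K10).
(* The relative error K - 1 of the factor in front of g(x). *)
have k1 : - (K - 1) * `|g x| <= k ^+ 2 / (2 * r) * M * h.
  have -> : k ^+ 2 / (2 * r) * M * h = k ^+ 2 / m%:R * M.
    by rewrite -hm; field; rewrite !gt_eqF.
  by rewrite -/k in K2; apply: ler_pM => //; [lra | lra | exact: gM].
have := ler_wpM2l c0 main.
have -> : c * (A + B * (d%:R * (h * (k ^+ 2 + 2 * r)))) =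
  K * (2 ^+ size w * h + e + D * d%:R * (2 * (k * h) ^+ 2) +
       2 * D * d%:R * (k ^+ 2 + 2 * r) * h) by rewrite /K /A /B; ring.
set E := (X in K * X).
have E0 : 0 <= E.
  by rewrite !addr_ge0 ?mulr_ge0 ?exprn_ge0 ?addr_ge0 ?sqr_ge0 ?mulr_ge0 // ?ltW.
have Eh : E <= e + (2 ^+ size w + D * d%:R * (2 * k ^+ 2) +
   2 * D * d%:R * (k ^+ 2 + 2 * r)) * h.
  have hh : h ^+ 2 <= h by nra.
  have : D * d%:R * (2 * (k * h) ^+ 2) <= D * d%:R * (2 * k ^+ 2) * h.
    rewrite exprMn [2 * (k ^+ 2 * _)]mulrA [D * d%:R * _]mulrA.
    by rewrite ler_wpM2l // !mulr_ge0 ?sqr_ge0.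
  by rewrite /E; lra.
have : K * E <= E by nra.
lra.
Qed.

End BernsteinEstimate.

(** * Rational coefficients *)

Section RationalBernstein.
Context {R : realType} {d : nat}.
Implicit Types (f : 'rV[R]_d -> R) (s w : seq 'I_d) (i j : 'I_d).

Local Notation basis i := (delta_mx 0 i : 'rV[R]_d).

Definition rat_barycentric (N : nat) i : mpoly d rat :=
  (2 * N%:R)^-1 *: (mpolyX rat (mnm1 i) + N%:R).

(** The same recursion carried out on polynomials.  Only the values v at the nodes
    and the weights enter the coefficients, so these are rational even though the
    nodes y and the mesh h are kept real. *)
Fixpoint casteljau_mpoly (N : nat) (h : R) s (v : 'rV[R]_d -> rat) (y : 'rV[R]_d)
    : mpoly d rat :=
  if s is i :: s' then
    rat_barycentric N i * casteljau_mpoly N h s' v (y + h *: basis i) +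
    (1 - rat_barycentric N i) * casteljau_mpoly N h s' v y
  else mpolyC d (v y).

Lemma ratmpoly_fun_casteljau N h s v y :
  ratmpoly_fun (casteljau_mpoly N h s v y) =
  fun x => casteljau h (fun i => (x 0 i - - N%:R) / (2 * N%:R)) s
    (fun y => ratr (v y)) y.
Proof.
apply/funext => x; elim: s y => [|i s IH] y; rewrite /ratmpoly_fun /=.
  by rewrite map_mpolyC mevalC.
have bary : meval (fun i => x 0 i) (map_mpoly (@ratr R) (rat_barycentric N i)) =
    (x 0 i - - N%:R) / (2 * N%:R).
  rewrite /rat_barycentric map_mpolyZ mevalZ rmorphD rmorph_nat /= map_mpolyX.
  rewrite mevalD mevalXU rmorph_nat fmorphV rmorphM !rmorph_nat opprK.
  by rewrite mulrC.
rewrite rmorphD !rmorphM rmorphB rmorph1 /= mevalD !mevalM mevalB meval1 bary.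
by rewrite -!/(ratmpoly_fun _ _) !IH.
Qed.

Lemma count_mword (beta : 'I_d -> nat) i : count_mem i (mword beta) = beta i.
Proof.
rewrite /mword count_flatten -map_comp sumnE big_map big_enum /=.
rewrite (bigD1 i) //= count_nseq /= eqxx mul1n big1 ?addn0 // => j ji.
by rewrite count_nseq /= (negbTE ji).
Qed.

Lemma rational_rounding (f : 'rV[R]_d -> R) (e : R) : 0 < e ->
  exists v : 'rV[R]_d -> rat, forall y, `|ratr (v y) - f y| <= e.
Proof.
move=> e0.
suff /boolp.choice[v vP] : forall y, exists q, `|ratr q - f y| <= e by exists v.
move=> y; have /rat_in_itvoo[q] : f y - e < f y + e by lra.
rewrite in_itv /= => /andP[q1 q2]; exists q.
by rewrite ler_norml; apply/andP; split; lra.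
Qed.

(** There are only finitely many multi-indices below gamma, so a single degree m
    and a single precision for the rounding serve all of them. *)
Lemma approx_on_cube (gamma : 'I_d -> nat) f (N : nat) (e : R) :
  C_multi gamma f -> (0 < N)%N -> 0 < e ->
  exists q : mpoly d rat,
    forall beta : 'I_d -> nat, (forall i, beta i <= gamma i)%N ->
    forall x, cube N%:R x ->
      `|mpderiv beta (ratmpoly_fun q) x - mpderiv beta f x| <= e.
Proof.
move=> hf N0 e0.
have r0 : 0 < N%:R :> R by rewrite ltr0n.
have e2 : 0 < e / 2 by lra.
pose G := \max_i gamma i.
pose T := {ffun 'I_d -> 'I_G.+1}.
pose word (t : T) := mword (fun i => t i : nat).
have /boolp.choice[C CP] : forall t : T, exists C, (forall i, t i <= gamma i)%N ->
    forall m s F, let h := 2 * N%:R / m%:R in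
    (0 < m)%N -> h <= 1 -> (forall i, count_mem i s = m) ->
    (forall y, `|F y - f y| <= h ^+ (size (word t)).+1) ->
    forall x, cube N%:R x ->
    `|pderivs (word t) (fun x =>
          casteljau h (fun i => (x 0 i - - N%:R) / (2 * N%:R)) s F
            (const_mx (- N%:R))) x
      - pderivs (word t) f x| <= e / 2 + C * h.
  move=> t; have [tg|tg] := pselect (forall i, t i <= gamma i)%N; last by exists 0.
  have [ex ct] := hf _ tg.
  by have [C CP] := bernstein_estimate r0 e2 ex ct; exists C.
pose S := \max_t size (word t).
pose D := \sum_t `|C t|.
have D0 : 0 <= D by apply: sumr_ge0.
(* Any m >= b makes h = 2N/m at most 1 and D h at most e/2. *)
pose b := 2 * N%:R * (1 + D / (e / 2)).
have b0 : 0 < b by rewrite !mulr_gt0 // ltr_pwDl // divr_ge0 // ltW.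
pose m := (Num.trunc b).+1.
have bm : b <= m%:R by rewrite ltW // truncnS_gt.
have m0 : 0 < m%:R :> R by rewrite ltr0n.
pose h : R := 2 * N%:R / m%:R.
have h0 : 0 < h by rewrite divr_gt0 // mulr_gt0.
have hD : h * (1 + D / (e / 2)) <= 1.
  by rewrite /h mulrAC ler_pdivrMr // mul1r.
have De : 0 <= D / (e / 2) by rewrite divr_ge0 // ltW.
have h1 : h <= 1 by apply: le_trans hD; rewrite ler_peMr ?(ltW h0) // lerDl.
have hDe : D * h <= e / 2.
  have : h * (D / (e / 2)) <= 1
    by apply: le_trans hD; rewrite ler_wpM2l ?(ltW h0) // lerDr.
  by rewrite mulrA ler_pdivrMr // mul1r mulrC.
have [v vf] := rational_rounding f (exprn_gt0 S.+1 h0).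
(* The word of the constant multi-index m takes m steps in every direction. *)
exists (casteljau_mpoly N h (mword (fun=> m)) v (const_mx (- N%:R))) => beta bg x xN.
have bG i : (beta i < G.+1)%N by rewrite ltnS (leq_trans (bg i)) // leq_bigmax.
pose t : T := [ffun i => Ordinal (bG i)].
have tb : (fun i => t i : nat) = beta by apply/funext => i; rewrite ffunE.
rewrite ratmpoly_fun_casteljau /mpderiv -tb -/(word t).
apply: (le_trans (CP t _ m (mword (fun=> m)) (fun y => ratr (v y)) _ h1 _ _ x xN)) => //.
- by move=> i; rewrite ffunE; apply: bg.
- by move=> i; rewrite count_mword.
- move=> y; apply: (le_trans (vf y)).
  rewrite -/h; apply: ler_wiXn2l; rewrite ?(ltW h0) //.
  by rewrite ltnS; apply: (leq_bigmax t).
have : C t * h <= D * h.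
  rewrite ler_wpM2r ?(ltW h0) //; apply: (le_trans (ler_norm _)).
  by rewrite /D (bigD1 t) //= lerDl sumr_ge0.
by rewrite -/h; lra.
Qed.

End RationalBernstein.

Theorem theorem6p10 (R : realType) (d : nat) (hd : (0 < d)%N)
    (gamma : 'I_d -> nat) (f : 'rV[R]_d -> R) (hf : C_multi gamma f) :
  exists q : nat -> mpoly.mpoly d rat,
    forall beta : 'I_d -> nat, (forall i : 'I_d, (beta i <= gamma i)%N) ->
      cvg_locally_uniform (fun n : nat => mpderiv beta (ratmpoly_fun (q n)))
        (mpderiv beta f).
Proof.
have /boolp.choice[q qP] : forall n : nat, exists q : mpoly d rat,
    forall beta : 'I_d -> nat, (forall i, beta i <= gamma i)%N ->
    forall x : 'rV[R]_d, cube n.+1%:R x ->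
      `|mpderiv beta (ratmpoly_fun q) x - mpderiv beta f x| <= n.+1%:R^-1.
  by move=> n; apply: approx_on_cube => //; rewrite invr_gt0 ltr0n.
exists q => beta bg K cK P /uniform_nbhs[E [entE EP]].
move: entE; rewrite -entourage_ballE => -[e /= e0 eE].
have [n0 Kn] := compact_sub_cube cK.
have : \forall n \near \oo, n.+1%:R^-1 < e by exact: near_infty_natSinv_lt (PosNum e0).
move=> [n1 _ n1e].
exists (maxn n0 n1) => // n /=; rewrite geq_max => /andP[nn0 nn1].
apply: EP => y Ky; apply: eE => /=.
rewrite /ball /= distrC.
apply: le_lt_trans (n1e n nn1).
by apply: qP => //; apply: (Kn n nn0).
Qed.
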